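(* Let ${\mathcal M}=(E,\rho)$ be a $q$-matroid of rank $r$ on $E=\mathbb{F}_q^n$, and let $I_{{\mathcal M}}$ be its order complex. Let $\{C_i : i\in S\}$, $S=\{1,\dots,s\}$, be the $q$-circuits of ${\mathcal M}$, and for $X\subseteq S$ let $C_X$ be the $\mathbb{F}_q$-linear span of the $C_i$, $i\in X$. For $i\ge1$ and $l\ge0$ let $\lambda_{i,l}$ be the number of subsets $X\subseteq S$ with $|X|=i$ such that $C_X$ has codimension $l$ in $E$. Then $$\chi(I_{{\mathcal M}})=(-1)^{r-1}q^{\binom{n}{2}}\,\overline{\mu}({\mathcal M})+\sum_{l=1}^{n-1}\sum_{i=1}^{s}\lambda_{i,l}\sum_{j=0}^{l}(-1)^{n+i+j-1}q^{\binom{n-j}{2}}{l\brack j}_q .$$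
   Context: A $q$-matroid is a pair $(E,\rho)$, $E=\mathbb{F}_q^n$, with $\rho$ from the set of subspaces of $E$ to $\mathbb{Z}_{\ge0}$ such that $0\le\rho(X)\le\dim X$, $\rho(X)\le\rho(Y)$ whenever $X\subseteq Y$, and $\rho(X+Y)+\rho(X\cap Y)\le\rho(X)+\rho(Y)$. Its rank is $\rho(E)$; its nullity function is $\eta(X)=\dim X-\rho(X)$. A subspace $U$ is independent if $\rho(U)=\dim U$. A $q$-cycle of nullity $i$ is a minimal (under inclusion) element of $\{X:\eta(X)=i\}$; $q$-circuits are the $q$-cycles of nullity $1$. The order complex $I_{{\mathcal M}}$ is the simplicial complex whose faces are the chains $V_1\subsetneq\cdots\subsetneq V_k$ ($k\ge0$, empty chain included) of nonzero independent subspaces; its reduced Euler characteristic is $\chi(I_{{\mathcal M}})=\sum_{k\ge0}(-1)^{k-1}f_k$, where $f_k$ is the number of such chains with $k$ members. Let $L$ be the set of $q$-cycles of ${\mathcal M}$ ordered by inclusion (a lattice with minimum $0=\{0\}$ and maximum $1$); its Möbius function is defined by $\mu(x,x)=1$ and $\mu(x,y)=-\sum_{x\le z<y}\mu(x,z)$, and $\mu(L)=\mu(0,1)$. The dual $q$-matroid ${\mathcal M}^*$ has rank function $\rho^*(X)=\dim X-\rho(E)+\rho(X^\perp)$ ($\perp$ with respect to the standard bilinear form); a coloop of ${\mathcal M}$ is a one-dimensional subspace $X$ with $\rho^*(X)=0$. Set $\overline{\mu}({\mathcal M})=|\mu(L)|$ if ${\mathcal M}$ has no coloop and $\overline{\mu}({\mathcal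 M})=0$ otherwise. ${l\brack j}_q=\prod_{i=0}^{j-1}\frac{q^l-q^i}{q^j-q^i}$ is the number of $j$-dimensional subspaces of $\mathbb{F}_q^l$. *)

(* Defs.v *)
From HB Require Import structures.
From mathcomp Require Import all_boot all_order all_algebra.
Set Implicit Arguments. Unset Strict Implicit. Unset Printing Implicit Defensive.
Import Order.TTheory GRing.Theory Num.Theory.
Import VectorInternalTheory.

HB.instance Definition _ (F : finFieldType) (vT : vectType F) :=
  [Countable of {vspace vT} by <:].
HB.instance Definition _ (F : finFieldType) (vT : vectType F) :=
  [Finite of {vspace vT} by <:].

Local Open Scope ring_scope.

Section QMatroid.
Variables (F : finFieldType) (n : nat).
Notation subsp := {vspace 'rV[F]_n}.
Variable rho : subsp -> nat.

(* q-matroid axioms (0 <= rho is automatic since rho is nat-valued) *)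
Definition is_qmatroid : Prop :=
  [/\ forall X : subsp, (rho X <= \dim X)%N,
      forall X Y : subsp, (X <= Y)%VS -> (rho X <= rho Y)%N &
      forall X Y : subsp, (rho (X + Y)%VS + rho (X :&: Y)%VS <= rho X + rho Y)%N].

Definition qrank : nat := rho fullv.

Definition nullity (X : subsp) : nat := (\dim X - rho X)%N.

Definition independent (U : subsp) : bool := rho U == \dim U.

Definition is_qcycle_of (X : subsp) (i : nat) : bool :=
  (nullity X == i) &&
  [forall Y : subsp, ((Y <= X)%VS && (Y != X)) ==> (nullity Y != i)].

Definition is_qcycle (X : subsp) : bool := is_qcycle_of X (nullity X).

Definition is_qcircuit (X : subsp) : bool := is_qcycle_of X 1.

Definition qcircuits : {set subsp} := [set C | is_qcircuit C].

(* Maximum 1 of the lattice L of q-cycles: since 1 belongs to L and contains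
   every element of L, it equals the sum of all q-cycles. *)
Definition cycle_top : subsp := (\sum_(X | is_qcycle X) X)%VS.

(* Mobius function of L, mu(x,x) = 1, mu(x,y) = - sum_{x <= z < y, z in L} mu(x,z);
   computed with fuel (strict inclusion decreases the dimension). *)
Fixpoint mobius_fuel (k : nat) (x y : subsp) : int :=
  match k with
  | 0 => 0
  | k'.+1 => if x == y then 1 else
      - \sum_(z : subsp | [&& is_qcycle z, (x <= z)%VS, (z <= y)%VS & z != y])
          mobius_fuel k' x z
  end.

Definition mobius_L : int := mobius_fuel (\dim cycle_top).+1 0%VS cycle_top.

Definition perp (X : subsp) : subsp :=
  <<[seq v <- enum 'rV[F]_n |
       [forall x : 'rV[F]_n, (x \in X) ==> ((v *m x^T) == 0%R)]]>>%VS.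

Definition rho_dual (X : subsp) : int :=
  (\dim X)%:Z - (qrank)%:Z + (rho (perp X))%:Z.

Definition is_coloop (X : subsp) : bool := (\dim X == 1)%N && (rho_dual X == 0%R).

Definition mubar : nat :=
  if [exists X : subsp, is_coloop X] then 0%N else `|mobius_L|%N.

(* order complex: a chain V_1 < ... < V_k of nonzero independent subspaces
   is identified with the set {V_1,...,V_k} (totally ordered by inclusion) *)
Definition is_indep_chain (Y : {set subsp}) : bool :=
  [forall V in Y, (V != 0%VS) && independent V] &&
  [forall V in Y, forall W in Y, (V <= W)%VS || (W <= V)%VS].

Definition nfaces (k : nat) : nat :=
  #|[set Y : {set subsp} | is_indep_chain Y && (#|Y| == k)]|.

(* reduced Euler characteristic: sum_{k >= 0} (-1)^(k-1) f_k
   (f_k = 0 for k > #|subspaces|) *)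
Definition chi_order_complex : int :=
  \sum_(k < #|{: subsp}|.+1) (-1) ^+ k.+1 * (nfaces k)%:Z.

Definition lambda (i l : nat) : nat :=
  #|[set X : {set subsp} | [&& X \subset qcircuits, #|X| == i &
       (n - \dim (\sum_(C in X) C)%VS)%N == l]]|.

End QMatroid.

Definition gauss_binom (q l j : nat) : rat :=
  \prod_(0 <= i < j) (((q ^ l)%:R - (q ^ i)%:R) / ((q ^ j)%:R - (q ^ i)%:R)).

(* Main.v *)
(* Let [mu] be the Moebius function of the lattice of all subspaces, so that
   [mu(0, V) = (-1)^d q^C(d,2)] with [d = dim V].

   Grouping the chains by their join gives
   [chi = - sum_{V independent} mu(0, V)].  A subspace is independent iff it
   contains no q-circuit, so inclusion-exclusion over the sets [X] of
   q-circuits turns this into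
   [- sum_X (-1)^|X| sum_{V >= C_X} mu(0, V)], and the inner sum depends only on
   the codimension [l] of [C_X]; it vanishes for [l = n > 0], and for
   [0 < l < n] it gives the Gaussian binomial sums.

   For [l = 0] the coefficient is [g(E)], where
   [g(V) = sum_{X : C_X = V} (-1)^|X|].  If [V] has a hyperplane [H] of the same
   nullity, then every q-circuit in [V] lies in [H], so [g(V) = 0].  Hence
   [g(E) = 0] when there is a coloop, and [g] vanishes off [L], on which it
   satisfies the recursion defining [mu_L(0, V)].  To get the sign of [g(E)],
   write [g(E) = h(0)] where
   [h(A) = sum_{V >= A, eta(V) = eta(A)} mu(V, E)]; for a hyperplane [H >= A]
   Weisner's theorem gives [h(A) = - sum_B h(B)], over the minimal [B >= A] of
   nullity [eta(A) + 1] that are not contained in [H], and induction shows that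
   [h(A)] has sign [(-1)^(eta(E) - eta(A))]. *)
Require Import Defs.
From HB Require Import structures.
From mathcomp Require Import all_boot all_order all_algebra all_field.
From mathcomp Require Import ring zify.
Set Implicit Arguments.
Unset Strict Implicit.
Unset Printing Implicit Defensive.
Import Order.TTheory GRing.Theory Num.Theory.
Local Open Scope ring_scope.

(** * Gaussian binomials and their alternating sum *)

Section GaussBinomial.

Variable q : nat.
Hypothesis q_gt1 : (1 < q)%N.

Let qX_inj : injective (fun i => (q ^ i)%:R : rat).
Proof. by move=> i j /eqP; rewrite eqr_nat eqn_exp2l // => /eqP. Qed.

Let qX_neq i j : i != j -> (q ^ i)%:R - (q ^ j)%:R != 0 :> rat.
Proof. by rewrite subr_eq0 (inj_eq qX_inj). Qed.

Let q_neq0 : q%:R != 0 :> rat.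
Proof. by rewrite pnatr_eq0 -lt0n ltnW. Qed.

Let qX_neq1 i : (0 < i)%N -> (q ^ i)%:R - 1 != 0 :> rat.
Proof. by move=> i0; apply: (@qX_neq i 0); rewrite -lt0n. Qed.

Lemma gauss_binom0 l : gauss_binom q l 0 = 1.
Proof. by rewrite /gauss_binom big_geq. Qed.

Lemma gauss_binom_small l j : (l < j)%N -> gauss_binom q l j = 0.
Proof.
move=> ltlj; rewrite /gauss_binom (bigD1_seq l) ?mem_index_iota ?iota_uniq //=.
by rewrite subrr !mul0r.
Qed.

Lemma gauss_binomSS l j :
  gauss_binom q l.+1 j.+1
  = ((q ^ l.+1)%:R - 1) / ((q ^ j.+1)%:R - 1) * gauss_binom q l j.
Proof.
rewrite /gauss_binom big_nat_recl //; congr (_ * _).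
apply: eq_bigr => i _; rewrite !expnS !natrM -!mulrBr invfM mulrACA.
by rewrite divff ?q_neq0 // mul1r.
Qed.

Definition qfact l : rat := \prod_(0 <= i < l) ((q ^ i.+1)%:R - 1).

Lemma qfactS l : qfact l.+1 = qfact l * ((q ^ l.+1)%:R - 1).
Proof. by rewrite /qfact big_nat_recr. Qed.

Lemma qfact_neq0 l : qfact l != 0.
Proof.
elim: l => [|l IHl]; first by rewrite /qfact big_geq.
by rewrite qfactS mulf_neq0 // qX_neq1.
Qed.

Lemma gauss_binomE l j :
  (j <= l)%N -> gauss_binom q l j = qfact l / (qfact j * qfact (l - j)).
Proof.
elim: j l => [|j IHj] [|l] //= lejl; rewrite ?subn0 ?gauss_binom0.
- by rewrite /qfact big_geq // mulr1 divr1.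
- by rewrite {2}/qfact big_geq // mul1r divff ?qfact_neq0.
rewrite gauss_binomSS IHj // subSS !qfactS.
move: (qfact_neq0 j) (qfact_neq0 (l - j)) (@qX_neq1 j.+1 isT) => ? ? ?.
by field; apply/and3P; split.
Qed.

Lemma gauss_binom_sub l j :
  (j <= l)%N -> gauss_binom q l (l - j) = gauss_binom q l j.
Proof.
by move=> le_jl; rewrite !gauss_binomE ?leq_subr // subKn // [X in _ / X]mulrC.
Qed.

Lemma gauss_binom_pascal l j :
  gauss_binom q l.+1 j.+1
  = gauss_binom q l j + (q ^ j.+1)%:R * gauss_binom q l j.+1.
Proof.
have [ltjl|ltlj|->] := ltngtP j l.
- have lejl := ltnW ltjl; rewrite !gauss_binomE // subSS.
  have -> : (l - j = (l - j.+1).+1)%N by lia.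
  rewrite !qfactS.
  have -> : (q ^ l.+1)%:R = (q ^ j.+1)%:R * (q ^ (l - j.+1).+1)%:R :> rat.
    by rewrite -natrM -expnD; congr (q ^ _)%:R; lia.
  move: (qfact_neq0 j) (qfact_neq0 (l - j.+1)) (@qX_neq1 j.+1 isT).
  move: (@qX_neq1 (l - j.+1).+1 isT) => ? ? ? ?.
  by field; apply/and4P; split.
- by rewrite !gauss_binom_small ?mulr0 ?addr0 // leqW.
have gauss_diag k : gauss_binom q k k = 1.
  rewrite gauss_binomE // subnn [qfact 0]/qfact big_geq // mulr1.
  by rewrite divff ?qfact_neq0.
by rewrite (@gauss_binom_small l l.+1) // mulr0 addr0 !gauss_diag.
Qed.

(* Since [C(k, 2) + k = C(k + 1, 2)], Pascal's rule makes the sum telescope. *)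
Lemma gauss_binom_alt_sum d :
  \sum_(0 <= k < d.+1) gauss_binom q d k * ((-1) ^+ k * (q ^ 'C(k, 2))%:R)
  = (d == 0)%:R.
Proof.
case: d => [|d]; first by rewrite big_nat1 gauss_binom0 !mul1r.
pose t k := (-1) ^+ k * (q ^ 'C(k.+1, 2))%:R * gauss_binom q d k.
rewrite big_nat_recl // gauss_binom0 !mul1r.
have step k : gauss_binom q d.+1 k.+1 * ((-1) ^+ k.+1 * (q ^ 'C(k.+1, 2))%:R)
    = t k.+1 - t k.
  by rewrite gauss_binom_pascal /t (binS k.+1) bin1 expnD natrM exprS; ring.
rewrite (eq_bigr (fun k => t k.+1 - t k)) => [|k _]; last exact: step.
rewrite telescope_sumr // /t (@gauss_binom_small d d.+1) // gauss_binom0.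
by rewrite mulr0 !mul1r sub0r subrr.
Qed.

End GaussBinomial.

(** * Counting subspaces in an interval *)

Section SubspaceCount.

Variables (F : finFieldType) (n : nat).
Local Notation subsp := {vspace 'rV[F]_n}.
Local Notation q := #|F|.
Implicit Types A V W : subsp.

Lemma card_field_gt1 : (1 < q)%N.
Proof. exact: finNzRing_gt1. Qed.

Definition subsp_between A V m : {set subsp} :=
  [set W | [&& (A <= W)%VS, (W <= V)%VS & \dim W == (\dim A + m)%N]].

Lemma natr_expB (Q k l : nat) : (0 < Q)%N ->
  ((Q ^ (k + l) - Q ^ k)%N)%:R = (Q ^ k)%:R * ((Q ^ l)%:R - 1) :> rat.
Proof.
by move=> Q0; rewrite natrB ?leq_pexp2l ?leq_addr // expnD natrM mulrBr mulr1.
Qed.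

Lemma card_vspaceD A W :
  (A <= W)%VS -> #|[set v in W | v \notin A]| = (q ^ \dim W - q ^ \dim A)%N.
Proof.
move=> sAW; rewrite -!(card_vspace (T := 'rV[F]_n)).
have -> : [set v in W | v \notin A] = [set v in W] :\: [set v in A].
  by apply/setP=> v; rewrite !inE andbC.
rewrite cardsD (setIidPr _); last by apply/subsetP=> v; rewrite !inE; apply: subvP.
by rewrite !cardsE.
Qed.

Lemma dim_add_line A (v : 'rV[F]_n) : v \notin A -> \dim (A + <[v]>) = (\dim A).+1.
Proof.
move=> vA; rewrite dimv_disjoint_sum ?dim_vline.
  by case: eqP vA => [->|_ _]; rewrite ?mem0v ?addn1.
apply/eqP; rewrite -subv0; apply/subvP=> w; rewrite memv_cap memv0.
case/andP=> wA /vlineP[k wE]; rewrite wE scaler_eq0; apply: contraR vA.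
rewrite negb_or => /andP[k0 _].
by rewrite -(scalerK k0 v) memvZ // -wE.
Qed.

(* Double counting of the pairs (v, W) with v in W \ A. *)
Lemma sum_card_subsp_between A V m :
  (\sum_(v in [set v in V | v \notin A]) #|subsp_between (A + <[v]>) V m|
   = \sum_(W in subsp_between A V m.+1) #|[set v in W | v \notin A]|)%N.
Proof.
under eq_bigr do rewrite -sum1_card.
under [RHS]eq_bigr do rewrite -sum1_card.
rewrite (exchange_big_dep (mem (subsp_between A V m.+1))) /= => [|v W]; last first.
  rewrite !inE subv_add => /andP[_ vA] /and3P[/andP[-> _] -> /eqP->].
  by rewrite dim_add_line // addSnnS eqxx.
apply: eq_bigr => W; rewrite inE => /and3P[sAW sWV /eqP dW].
apply: eq_bigl => v; rewrite !inE subv_add sAW sWV dW /= -memvE.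
have [vA|vA] := boolP (v \in A); rewrite ?andbF // dim_add_line // addSnnS eqxx.
by rewrite !andbT andbC andb_idr // => /(subvP sWV).
Qed.

(** Induction on [m]: each [W] is weighted by its vectors outside [A], and adjoining such a vector
    to [A] leaves an interval of length one less. *)
Lemma card_subsp_between A V m : (A <= V)%VS ->
  #|subsp_between A V m|%:R = gauss_binom q (\dim V - \dim A) m.
Proof.
elim: m A => [|m IHm] A sAV.
  rewrite gauss_binom0 (_ : subsp_between _ _ _ = [set A]) ?cards1 //.
  apply/setP=> W; rewrite !inE addn0 andbA; apply/idP/eqP=> [|->]; last first.
    by rewrite subvv sAV eqxx.
  case/andP=> /andP[sAW _] /eqP dW.
  by apply/eqP; rewrite eq_sym eqEdim sAW dW leqnn.
have := congr1 (fun k => k%:R : rat) (sum_card_subsp_between A V m).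
rewrite !natr_sum.
rewrite (eq_bigr (fun=> gauss_binom q (\dim V - (\dim A).+1) m)); last first.
  move=> v; rewrite inE => /andP[vV vA].
  by rewrite IHm ?dim_add_line // subv_add sAV -memvE.
rewrite [RHS](eq_bigr (fun=> ((q ^ (\dim A + m.+1) - q ^ \dim A)%N)%:R)); last first.
  by move=> W; rewrite inE => /and3P[sAW _ /eqP dW]; rewrite card_vspaceD // dW.
rewrite !sumr_const card_vspaceD //.
(* If [A = V], the truncated [\dim V - (\dim A).+1] is not a predecessor of [\dim V - \dim A]; both
   sides are then zero. *)
have [eqAV|ltAV] := leqP (\dim V) (\dim A).
  move=> _; rewrite gauss_binom_small ?(eqP eqAV) //.
  rewrite (_ : subsp_between _ _ _ = set0) ?cards0 //; apply/setP=> W.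
  rewrite !inE; apply/negP=> /and3P[_ /dimvS lWV /eqP]; lia.
have -> : (\dim V - \dim A = (\dim V - (\dim A).+1).+1)%N by lia.
rewrite gauss_binomSS; last exact: card_field_gt1.
set g := gauss_binom _ _ _; set N := #|subsp_between _ _ _|.
have -> : (q ^ \dim V - q ^ \dim A)%N
    = (q ^ (\dim A + (\dim V - (\dim A).+1).+1) - q ^ \dim A)%N.
  by congr (_ ^ _ - _)%N; lia.
have q_gt0 := ltnW card_field_gt1.
rewrite -[RHS]mulr_natl -[LHS]mulr_natl !natr_expB //.
have qA : (q ^ \dim A)%:R != 0 :> rat by rewrite pnatr_eq0 -lt0n expn_gt0 q_gt0.
have qm : (q ^ m.+1)%:R - 1 != 0 :> rat.
  by rewrite subr_eq0 pnatr_eq1 -(expn0 q) eqn_exp2l ?card_field_gt1.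
rewrite [RHS]mulrCA -[LHS]mulrA => /(mulfI qA) E.
by apply: (mulIf qm); rewrite -E mulrAC divfK.
Qed.

Lemma sum_subsp_between A V (f : nat -> rat) : (A <= V)%VS ->
  \sum_(W | (A <= W)%VS && (W <= V)%VS) f (\dim W)
  = \sum_(0 <= m < (\dim V - \dim A).+1)
      gauss_binom q (\dim V - \dim A) m * f (\dim A + m)%N.
Proof.
move=> sAV; rewrite big_mkord.
rewrite (partition_big (fun W => inord (\dim W - \dim A) : 'I_(\dim V - \dim A).+1)
  predT) //=; apply: eq_bigr => m _.
rewrite -card_subsp_between // -sum1_card natr_sum mulr_suml.
have dimE W : (A <= W)%VS && (W <= V)%VS ->
    (inord (\dim W - \dim A) == m) = (\dim W == \dim A + m)%N.
  case/andP=> /dimvS ? /dimvS ?; rewrite -val_eqE /= inordK; lia.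
apply: eq_big => [W|W /andP[sW]].
  rewrite inE andbA; have [sW|//] := boolP ((A <= W) && (W <= V))%VS.
  by rewrite dimE.
by rewrite dimE // => /eqP->; rewrite mul1r.
Qed.

End SubspaceCount.

(** * Alternating sums over families of finite sets *)

Section SignedSetSums.

Variable T : finType.
Implicit Types X Y : {set T}.

(** Adding or removing [a] is a sign-reversing involution on the sets satisfying [P]. *)
Lemma sum_sign_toggle (P : pred {set T}) (a : T) :
    (forall Y, a \notin Y -> P (a |: Y) = P Y) ->
  \sum_(Y | P Y) (-1) ^+ #|Y| = 0 :> rat.
Proof.
move=> Pa; rewrite (bigID (fun Y => a \in Y)) /=.
rewrite (reindex_onto (fun Y => a |: Y) (fun Y => Y :\ a)) /=; last first.
  by move=> Y /andP[_ aY]; rewrite setD1K.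
rewrite (eq_big (fun Y => P Y && (a \notin Y)) (fun Y => - (-1) ^+ #|Y|)).
- by rewrite sumrN addNr.
- move=> Y; rewrite setU11 andbT; have [aY|aY] := boolP (a \in Y).
    rewrite andbF; apply/negP=> /andP[_ /eqP E].
    by move: aY; rewrite -E !inE eqxx.
  by rewrite Pa // setU1K // eqxx andbT.
move=> Y /andP[_ /eqP E]; have aY : a \notin Y by rewrite -E !inE eqxx.
by rewrite cardsU1 aY exprS mulN1r.
Qed.

Lemma sum_sign_subset (A : {set T}) :
  \sum_(X : {set T} | X \subset A) (-1) ^+ #|X| = (A == set0)%:R :> rat.
Proof.
have [->|[a aA]] := set_0Vmem A.
  rewrite eqxx (big_pred1 set0) ?cards0 // => X.
  by rewrite subset0.
rewrite (sum_sign_toggle (a := a)) => [|Y _]; last first.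
  by rewrite subUset sub1set aA.
by case: eqP aA => // ->; rewrite inE.
Qed.

End SignedSetSums.

(* The Moebius number of an interval of length [d] in a subspace lattice. *)
Definition qmu (q d : nat) : rat := (-1) ^+ d * (q ^ 'C(d, 2))%:R.

Lemma ltn_dimv (K : fieldType) (vT : vectType K) (U V : {vspace vT}) :
  (U <= V)%VS -> U != V -> (\dim U < \dim V)%N.
Proof.
move=> sUV neUV; rewrite ltn_neqAle dimvS // andbT.
by apply: contraNneq neUV => E; rewrite eqEdim sUV E leqnn.
Qed.

(** * Möbius function of the subspace lattice, and chains with a given join *)

Section SubspaceMobius.

Variables (F : finFieldType) (n : nat).
Local Notation subsp := {vspace 'rV[F]_n}.
Local Notation q := #|F|.
Implicit Types (A H V W : subsp) (Y : {set subsp}).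

Lemma dim_fullrV : \dim {:'rV[F]_n} = n.
Proof. by rewrite dimvf dim_matrix; exact: mul1n. Qed.

Lemma dimv_le_n V : (\dim V <= n)%N.
Proof. by rewrite -[n in (_ <= n)%N]dim_fullrV dimvS ?subvf. Qed.

Lemma sum_qmu_below V : \sum_(W | (W <= V)%VS) qmu q (\dim W) = (V == 0%VS)%:R.
Proof.
under eq_bigl => W do rewrite -[(W <= V)%VS]andTb -(sub0v W).
rewrite (sum_subsp_between (qmu q)) ?sub0v // dimv0 subn0.
by rewrite gauss_binom_alt_sum ?card_field_gt1 // dimv_eq0.
Qed.

(** The index is reversed by the symmetry of Gaussian binomials, so [j] is the codimension of [V] in
    $E$. *)
Lemma sum_above W (f : nat -> rat) :
  \sum_(V | (W <= V)%VS) f (\dim V)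
  = \sum_(0 <= j < (n - \dim W).+1) gauss_binom q (n - \dim W) j * f (n - j)%N.
Proof.
under eq_bigl => V do rewrite -[(W <= V)%VS]andbT -(subvf V).
rewrite (sum_subsp_between f) ?subvf // dim_fullrV big_nat_rev /=.
have lWn := dimv_le_n W.
rewrite !big_nat; apply: eq_bigr => j /andP[_]; rewrite ltnS => le_j.
rewrite add0n subSS gauss_binom_sub ?card_field_gt1 //.
by congr (_ * f _); lia.
Qed.

(** [qmu q (n - \dim V)] is $\mu(V,E)$, so this is the Möbius recursion read from the top. *)
Lemma sum_qmu_codim_above W :
  \sum_(V | (W <= V)%VS) qmu q (n - \dim V) = (W == fullv)%:R.
Proof.
rewrite (sum_above W (fun d => qmu q (n - d))).
have -> : (W == fullv) = (n - \dim W == 0)%N.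
  by rewrite eqEdim subvf dim_fullrV subn_eq0.
rewrite -(gauss_binom_alt_sum (card_field_gt1 F)) !big_nat.
apply: eq_bigr => j /andP[_]; rewrite ltnS => le_j; rewrite subKn //.
exact: leq_trans le_j (leq_subr _ _).
Qed.

(* Weisner's theorem for the lattice of all subspaces. *)
Lemma sum_qmu_codim_cap H W : H != fullv -> (W <= H)%VS ->
  \sum_(V | (V :&: H)%VS == W) qmu q (n - \dim V) = 0.
Proof.
move=> ntH; have [k] := ubnP (n - \dim W)%N.
elim: k W => // k IHk W; rewrite ltnS => leWk sWH.
have: \sum_(V | (W <= V)%VS) qmu q (n - \dim V) = 0.
  rewrite sum_qmu_codim_above; case: eqP => // WT.
  by case/eqP: ntH; apply/eqP; rewrite eqEsubv subvf -WT.
(* The sum over all [V] above [W] is zero; split by [V :&: H], every class other than that of [W]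
   vanishes by induction. *)
rewrite (partition_big (fun V => (V :&: H)%VS)
  (fun U => (W <= U)%VS && (U <= H)%VS)) /=; last first.
  by move=> V sWV; rewrite subv_cap sWV sWH capvSr.
rewrite (bigD1 W) ?subvv ?sWH //= [X in _ + X]big1 ?addr0 => [|U].
  move=> E; rewrite -[RHS]E; apply: eq_bigl => V.
  by rewrite andb_idl // => /eqP<-; rewrite capvSl.
case/andP=> /andP[sWU sUH] neUW.
rewrite -[RHS](IHk U) //; last first.
  have: (\dim W < \dim U)%N by rewrite ltn_dimv // eq_sym.
  by move: (dimv_le_n U) => *; lia.
apply: eq_bigl => V; rewrite andb_idl // => /eqP E.
by rewrite (subv_trans sWU) // -E capvSl.
Qed.

Lemma eq_sum_below (f g : subsp -> rat) :
    (forall V, \sum_(W | (W <= V)%VS) f W = \sum_(W | (W <= V)%VS) g W) ->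
  f =1 g.
Proof.
move=> fg V; have [k] := ubnP (\dim V); elim: k V => // k IHk V leVk.
have := fg V; rewrite (bigD1 V) ?subvv // [RHS](bigD1 V) ?subvv //=.
rewrite (eq_bigr g) => [|W /andP[sWV neWV]]; first exact: addIr.
by apply: IHk; rewrite -ltnS (leq_trans _ leVk) // !ltnS ltn_dimv.
Qed.

Definition nz_chain Y :=
  [forall V in Y, V != 0%VS] &&
  [forall V in Y, forall W in Y, (V <= W)%VS || (W <= V)%VS].

Lemma nz_chainP Y : reflect ({in Y, forall V, V != 0%VS} /\
  {in Y &, forall V W, (V <= W)%VS || (W <= V)%VS}) (nz_chain Y).
Proof.
apply: (iffP andP) => [[/forall_inP nzY /forall_inP cY]|[nzY cY]].
  by split=> // V W VY WY; have /forall_inP := cY V VY; apply.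
by split; apply/forall_inP=> // V VY; apply/forall_inP=> W; apply: cY.
Qed.

Definition join Y : subsp := (\sum_(V in Y) V)%VS.

Lemma joinP Y V : reflect (forall W, W \in Y -> (W <= V)%VS) (join Y <= V)%VS.
Proof. exact: subv_sumP. Qed.

Lemma sub_join Y V : V \in Y -> (V <= join Y)%VS.
Proof. by move=> VY; apply: (sumv_sup V). Qed.

Lemma join0 : join set0 = 0%VS.
Proof. by rewrite /join big_set0. Qed.

Lemma nz_chain_join Y : nz_chain Y -> Y != set0 -> join Y \in Y.
Proof.
case/nz_chainP=> _ cY /set0Pn[V0 V0Y].
case: (@arg_maxnP _ V0 (mem Y) (fun V => \dim V)) => // V VY maxV.
suff -> : join Y = V by [].
apply/eqP; rewrite eqEsubv sub_join // andbT; apply/joinP => W WY.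
have /orP[sVW|//] := cY V W VY WY.
suff /eqP-> : V == W by rewrite subvv.
by rewrite eqEdim sVW; apply: maxV.
Qed.

(** Philip Hall's theorem. Summed over the subspaces of [V], both sides give one if [V = 0] and zero
    otherwise: adding or removing [V] itself pairs the chains below a nonzero [V]. *)
Lemma sum_nz_chain V :
  \sum_(Y | nz_chain Y && (join Y == V)) (-1) ^+ #|Y| = qmu q (\dim V).
Proof.
move: V; pose c V : rat := \sum_(Y | nz_chain Y && (join Y == V)) (-1) ^+ #|Y|.
apply: (eq_sum_below (f := c)) => V.
rewrite sum_qmu_below.
rewrite (exchange_big_dep (fun Y => nz_chain Y && (join Y <= V)%VS)) /=; last first.
  by move=> W Y sWV /andP[-> /eqP->].
rewrite (eq_bigr (fun Y => (-1) ^+ #|Y|)) => [|Y /andP[cY sYV]]; last first.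
  by rewrite (big_pred1 (join Y)) // => W; rewrite cY /= eq_sym andb_idl // => /eqP->.
have [->|ntV] := eqVneq V 0%VS.
  rewrite (big_pred1 set0) ?cards0 // => Y; rewrite subv0; apply/idP/eqP => [|->].
    case/andP=> cY /eqP Y0; apply/eqP/negP => /negP/(nz_chain_join cY).
    by have /nz_chainP[nzY _] := cY; rewrite Y0 => /nzY; rewrite eqxx.
  by rewrite join0 eqxx andbT; apply/nz_chainP; split=> W; rewrite inE.
apply: (sum_sign_toggle (a := V)) => Y VY.
apply/andP/andP => -[/nz_chainP[nzY cY] /joinP sYV].
  split; last by apply/joinP => W WY; apply: sYV; rewrite inE WY orbT.
  apply/nz_chainP; split=> [W WY|W U WY UY]; first by rewrite nzY // inE WY orbT.
  by rewrite cY // inE ?WY ?UY orbT.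
split; first apply/nz_chainP; last first.
  by apply/joinP => W; rewrite !inE => /predU1P[->|/sYV//]; rewrite subvv.
split=> [W|W U]; rewrite !inE; first by case/predU1P=> [->//|/nzY].
case/predU1P=> [->|WY] /predU1P[->|UY]; rewrite ?subvv //.
- by rewrite (sYV U) ?orbT.
- by rewrite sYV.
exact: cY.
Qed.

End SubspaceMobius.

(** * Nullity, q-circuits, and alternating sums over sets of q-circuits *)

Section QMatroidNullity.

Variables (F : finFieldType) (n : nat).
Local Notation subsp := {vspace 'rV[F]_n}.
Local Notation q := #|F|.
Variable rho : subsp -> nat.
Hypothesis rhoP : is_qmatroid rho.
Implicit Types (A B C H U V W Z : subsp) (X : {set subsp}).
Local Notation eta := (nullity rho).

Lemma hyperplane_between A V : (A <= V)%VS -> A != V ->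
  exists H, [/\ (A <= H)%VS, (H <= V)%VS & (\dim H).+1 = \dim V].
Proof.
move=> sAV neAV.
pose P W := [&& (A <= W)%VS, (W <= V)%VS & W != V].
have PA : P A by rewrite /P subvv sAV.
case: (@arg_maxnP _ A P (fun W => \dim W) PA) => H /and3P[sAH sHV neHV] maxH.
exists H; split=> //; apply/eqP; rewrite eqn_leq ltn_dimv //=.
have /subvPn[v vV vH] : ~~ (V <= H)%VS.
  by apply: contraNN neHV => sVH; rewrite eqEsubv sHV.
rewrite leqNgt; apply/negP => ltHV.
have := maxH (H + <[v]>)%VS; rewrite dim_add_line // /P.
rewrite (subv_trans sAH) ?addvSl // subv_add sHV -memvE vV /=.
case: eqP => [E|_ /(_ isT)]; last by rewrite ltnn.
by move: ltHV; rewrite -{1}E dim_add_line // ltnn.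
Qed.

Lemma nullityK V : (nullity rho V + rho V = \dim V)%N.
Proof. by case: rhoP => rho_le _ _; rewrite subnK. Qed.

(** Submodularity for [U] and a complement of [U] in [V] bounds the growth of the rank by
    [\dim V - \dim U]. *)
Lemma nullityS U V : (U <= V)%VS -> (eta U <= eta V)%N.
Proof.
case: rhoP => rho_le _ rho_sub sUV.
have := rho_sub (V :\: U)%VS U; rewrite addv_diff (addv_idPl sUV) => rVU.
have := dimv_disjoint_sum (capv_diff V U).
rewrite addv_diff (addv_idPl sUV) => dVU.
have := rho_le (V :\: U)%VS; have := nullityK U; have := nullityK V; lia.
Qed.

Lemma nullity_supermod U V :
  (eta U + eta V <= eta (U + V)%VS + eta (U :&: V)%VS)%N.
Proof.
case: rhoP => _ _ /(_ U V); have := dimv_sum_cap U V.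
have := nullityK U; have := nullityK V.
have := nullityK (U + V)%VS; have := nullityK (U :&: V)%VS; lia.
Qed.

Lemma nullity_hyperplane H V : (H <= V)%VS -> (\dim V <= (\dim H).+1)%N ->
  (eta V <= (eta H).+1)%N.
Proof.
case: rhoP => _ /(_ H V) rho_mono _ /rho_mono.
have := nullityK H; have := nullityK V; lia.
Qed.

Lemma nullity0 : eta 0%VS = 0%N.
Proof. by rewrite /nullity dimv0. Qed.

Lemma independentE V : independent rho V = (eta V == 0%N).
Proof.
by rewrite /independent; have := nullityK V => ?; apply/eqP/eqP; lia.
Qed.

Lemma independentS U V : (U <= V)%VS -> independent rho V -> independent rho U.
Proof. by move=> /nullityS; rewrite !independentE -!leqn0; apply: leq_trans. Qed.

Lemma qcycle_ofP V i : reflect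
  (eta V = i /\ forall U, (U <= V)%VS -> U != V -> eta U != i) (is_qcycle_of rho V i).
Proof.
apply: (iffP andP) => [[/eqP eV /forallP minV]|[/eqP eV minV]]; split=> //.
  by move=> U sUV neUV; have /implyP := minV U; apply; rewrite sUV.
by apply/forallP=> U; apply/implyP => /andP[]; apply: minV.
Qed.

Lemma qcircuit_proper C U : C \in qcircuits rho -> (U <= C)%VS -> U != C -> eta U = 0%N.
Proof.
rewrite inE => /qcycle_ofP[eC minC] sUC neUC.
have := minC U sUC neUC; have := nullityS sUC; rewrite eC; lia.
Qed.

Lemma nullity_qcircuit C : C \in qcircuits rho -> eta C = 1%N.
Proof. by rewrite inE => /qcycle_ofP[]. Qed.

(** A dependent subspace of least dimension inside [V] has an independent hyperplane, hence nullity
    exactly 1, and is a q-circuit. *)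
Lemma dependentP V :
  reflect (exists2 C, C \in qcircuits rho & (C <= V)%VS) (~~ independent rho V).
Proof.
rewrite independentE -lt0n; apply: (iffP idP) => [dV|[C cC /nullityS]]; last first.
  by rewrite nullity_qcircuit.
pose P W := (W <= V)%VS && (0 < eta W)%N.
have PV : P V by rewrite /P subvv.
case: (@arg_minnP _ V P (fun W => \dim W) PV) => C /andP[sCV dC] minC.
have minC' U : (U <= C)%VS -> U != C -> eta U = 0%N.
  move=> sUC neUC; apply/eqP; rewrite -leqn0 leqNgt; apply/negP => dU.
  have := minC U; rewrite /P (subv_trans sUC) // => /(_ dU).
  by rewrite leqNgt ltn_dimv.
exists C => //; rewrite inE; apply/qcycle_ofP; split; last first.
  by move=> U sUC neUC; rewrite minC'.
have [|H [_ sHC dH]] := @hyperplane_between 0 C (sub0v _).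
  by apply: contraTneq dC => <-; rewrite nullity0.
have neHC : H != C by apply: contra_eq_neq dH => ->; lia.
have := nullity_hyperplane sHC; rewrite dH leqnn (minC' H) // => /(_ isT); lia.
Qed.

(* Supermodularity of the nullity: [H] has the same nullity as [V], so [C :&: H]
   has nullity 1 and cannot be proper in [C]. *)
Lemma qcircuit_sub_hyperplane C H V :
    C \in qcircuits rho -> (C <= V)%VS -> (H <= V)%VS -> eta H = eta V ->
  (C <= H)%VS.
Proof.
move=> cC sCV sHV eHV; apply/capv_idPl/eqP; apply: contraT => neCH.
have := nullity_supermod C H.
rewrite (qcircuit_proper cC (capvSl _ _) neCH) nullity_qcircuit // addn0.
have /nullityS : (C + H <= V)%VS by rewrite subv_add sCV sHV.
lia.
Qed.

(** The index sets [X] are all the subsets of the set of q-circuits inside [V], so the sum vanishes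
    unless that set is empty. *)
Lemma sum_sign_qcircuits_sub V :
  \sum_(X : {set subsp} | (X \subset qcircuits rho) && (join X <= V)%VS) (-1) ^+ #|X|
  = (independent rho V)%:R :> rat.
Proof.
rewrite (eq_bigl (fun X : {set subsp} =>
  X \subset [set C in qcircuits rho | (C <= V)%VS])).
  rewrite sum_sign_subset -[_ == set0]negbK -[independent _ _]negbK.
  congr (nat_of_bool (~~ _))%:R.
  apply/set0Pn/dependentP => [[C]|[C cC sCV]]; last by exists C; rewrite inE cC.
  by rewrite inE => /andP[]; exists C.
move=> X; apply/andP/subsetP => [[/subsetP sX /joinP jX] C CX|sX].
  by rewrite inE sX ?jX.
by split; [apply/subsetP=> C /sX|apply/joinP=> C /sX]; rewrite inE => /andP[].
Qed.

(** The function $g$ of the outline. *)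
Definition spanning_sum V : rat :=
  \sum_(X : {set subsp} | (X \subset qcircuits rho) && (join X == V)) (-1) ^+ #|X|.

Lemma sum_spanning_sum V :
  \sum_(W | (W <= V)%VS) spanning_sum W = (independent rho V)%:R.
Proof.
rewrite -sum_sign_qcircuits_sub.
rewrite (exchange_big_dep (fun X : {set subsp} =>
  (X \subset qcircuits rho) && (join X <= V)%VS)) /=.
  apply: eq_bigr => X /andP[sX jX].
  rewrite (big_pred1 (join X)) // => W; rewrite sX /= eq_sym.
  by rewrite andb_idl // => /eqP->.
by move=> W X sWV /andP[-> /eqP->].
Qed.

(** All q-circuits inside [V] lie in [H], so no set of them has join [V]; [H] may be any proper
    subspace of the same nullity. *)
Lemma spanning_sum_hyperplane H V :
  (H <= V)%VS -> H != V -> eta H = eta V -> spanning_sum V = 0.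
Proof.
move=> sHV neHV eHV; rewrite /spanning_sum big_pred0 // => X.
apply/negP => /andP[/subsetP sX /eqP jX]; case/negP: neHV.
rewrite eqEsubv sHV -{1}jX; apply/joinP => C CX.
by apply: qcircuit_sub_hyperplane eHV; rewrite ?sX // -jX sub_join.
Qed.

Lemma spanning_sum_noncycle V : ~~ is_qcycle rho V -> spanning_sum V = 0.
Proof.
rewrite /is_qcycle /is_qcycle_of eqxx negb_forall => /existsP[U].
rewrite negb_imply negbK => /andP[/andP[sUV neUV] /eqP].
exact: spanning_sum_hyperplane.
Qed.

(** Fuel above the dimension suffices, as recursive calls go to strictly smaller subspaces. The
    recursion for $g$ over all subspaces reduces to the one over $L$ because $g$ vanishes off
    $L$. *)
Lemma mobius_fuelE k V : is_qcycle rho V -> (\dim V < k)%N ->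
  (mobius_fuel rho k 0%VS V)%:~R = spanning_sum V.
Proof.
elim: k V => // k IHk V cV; rewrite ltnS => leVk /=.
have := sum_spanning_sum V; have [<- |ntV] := eqVneq 0%VS V.
  rewrite independentE nullity0 (big_pred1 0%VS) // => W.
  by rewrite subv0.
rewrite (bigD1 V) ?subvv //= independentE.
case: eqP => [eV|_ /eqP]; last first.
  rewrite addr_eq0 => /eqP->; rewrite rmorphN rmorph_sum; congr (- _).
  rewrite [RHS](bigID (is_qcycle rho)) /= [X in _ + X]big1 ?addr0.
    rewrite (eq_bigl (fun W => (W <= V)%VS && (W != V) && is_qcycle rho W)).
      apply: eq_bigr => W /andP[/andP[sWV neWV] cW].
      by rewrite IHk // (leq_trans _ leVk) // ltn_dimv.
    by move=> W; rewrite sub0v /= andbC.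
  by move=> W /andP[_]; apply: spanning_sum_noncycle.
have /qcycle_ofP[_ /(_ _ (sub0v V) ntV)] := cV.
by rewrite nullity0 eV.
Qed.

End QMatroidNullity.

(** * The sign of $g(E)$ through Weisner's theorem *)

Section SignOfMobius.

Variables (F : finFieldType) (n : nat).
Local Notation subsp := {vspace 'rV[F]_n}.
Local Notation q := #|F|.
Variable rho : subsp -> nat.
Hypothesis rhoP : is_qmatroid rho.
Implicit Types (A B C H U V W Z : subsp) (X : {set subsp}).
Local Notation eta := (nullity rho).

(* [mu_above A] plays the part of the Moebius number of the interval of [L]
   above [A], written as a sum over the lattice of all subspaces. *)
Definition mu_above A : rat :=
  \sum_(V | (A <= V)%VS && (eta V == eta A)) qmu q (n - \dim V).

(** For [A = 0] these are the q-circuits; in general they stand in for the atoms above [A] in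
    $L$. *)
Definition nullity_atom A B :=
  [&& (A <= B)%VS, eta B == (eta A).+1 &
   [forall Z : subsp,
      [&& (A <= Z)%VS, (Z <= B)%VS & Z != B] ==> (eta Z != (eta A).+1)]].

Lemma nullity_atomP A B : reflect [/\ (A <= B)%VS, eta B = (eta A).+1 &
    forall Z, (A <= Z)%VS -> (Z <= B)%VS -> eta Z = (eta A).+1 -> Z = B]
  (nullity_atom A B).
Proof.
apply: (iffP and3P) => [[sAB /eqP eB /forallP minB]|[sAB eB minB]].
  split=> // Z sAZ sZB eZ; apply/eqP; apply: contraT => neZB.
  by have /implyP/(_ _)/negP[] := minB Z; rewrite ?sAZ ?sZB ?eZ.
split; rewrite ?eB //; apply/forallP=> Z; apply/implyP=> /and3P[sAZ sZB].
by apply: contraNN => /eqP/(minB Z sAZ sZB)->.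
Qed.

(* By supermodularity of the nullity such subspaces of [V] are closed under
   intersection. *)
Lemma nullity_atom_exists A V : (A <= V)%VS -> eta V = (eta A).+1 ->
  exists B, [/\ nullity_atom A B, (B <= V)%VS &
    forall Z, (A <= Z)%VS -> (Z <= V)%VS -> eta Z = (eta A).+1 -> (B <= Z)%VS].
Proof.
move=> sAV eV.
pose P Z := [&& (A <= Z)%VS, (Z <= V)%VS & eta Z == (eta A).+1].
have PV : P V by rewrite /P sAV subvv eV eqxx.
case: (@arg_minnP _ V P (fun W => \dim W) PV) => B /and3P[sAB sBV /eqP eB] minB.
have leB Z : (A <= Z)%VS -> (Z <= V)%VS -> eta Z = (eta A).+1 -> (B <= Z)%VS.
  move=> sAZ sZV eZ; apply/capv_idPl/eqP; apply: contraT => neB.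
  have /negP[] : ~~ P (B :&: Z)%VS.
    by apply: contraL (ltn_dimv (capvSl B Z) neB) => /minB; rewrite -leqNgt.
  rewrite /P subv_cap sAB sAZ (subv_trans (capvSl _ _)) //=.
  have := nullity_supermod rhoP B Z.
  have /(nullityS rhoP) : (B + Z <= V)%VS by rewrite subv_add sBV sZV.
  have := nullityS rhoP (capvSl B Z); lia.
exists B; split=> //; apply/nullity_atomP; split=> // Z sAZ sZB eZ.
by apply/eqP; rewrite eqEsubv sZB leB // (subv_trans sZB).
Qed.

(** Weisner's theorem, summed over the [W] between [A] and [H] of nullity [eta A], kills the sum of
    $\mu(V,E)$ over the [V] above [A] with [eta (V :&: H) = eta A]. Such [V] have nullity [eta A] or
    one more: the former give [mu_above A], the latter are grouped by the unique atom they
    contain. *)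
Lemma mu_above_rec A H : (A <= H)%VS -> (\dim H).+1 = n ->
  mu_above A = - \sum_(B | nullity_atom A B && ~~ (B <= H)%VS) mu_above B.
Proof.
move=> sAH dH.
have ntH : H != fullv.
  by apply: contra_eq_neq dH => ->; rewrite dim_fullrV; lia.
have eH V : (eta V <= (eta (V :&: H)).+1)%N.
  apply: (nullity_hyperplane rhoP); first exact: capvSl.
  by have := dimv_sum_cap V H; have := dimv_le_n (V + H)%VS; lia.
pose Q V := (A <= V)%VS && (eta (V :&: H)%VS == eta A).
have: \sum_(V | Q V) qmu q (n - \dim V) = 0.
  rewrite (partition_big (fun V => (V :&: H)%VS)
    (fun W => [&& (A <= W)%VS, (W <= H)%VS & eta W == eta A])) /=.
    apply: big1 => W /and3P[sAW sWH eW].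
    rewrite -[RHS](sum_qmu_codim_cap ntH sWH); apply: eq_bigl => V.
    rewrite andb_idl // => /eqP E; rewrite /Q E eW andbT.
    by rewrite (subv_trans sAW) // -E capvSl.
  by move=> V /andP[sAV ->]; rewrite subv_cap sAV sAH capvSr.
rewrite (bigID (fun V => eta V == eta A)) /=.
rewrite (eq_bigl (fun V => (A <= V)%VS && (eta V == eta A))); last first.
  move=> V; rewrite /Q; have [eV|] := eqVneq (eta V); rewrite ?andbF // !andbT.
  apply/andb_idr => sAV; rewrite eqn_leq -{1}eV (nullityS rhoP (capvSl _ _)).
  by rewrite (nullityS rhoP) // subv_cap sAV.
move/eqP; rewrite addr_eq0 => /eqP E; rewrite /mu_above E; congr (- _).
pose atom V B := [&& nullity_atom A B, (B <= V)%VS & [forall Z : subsp,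
  [&& (A <= Z)%VS, (Z <= V)%VS & eta Z == (eta A).+1] ==> (B <= Z)%VS]].
(* [f V] is the least subspace between [A] and [V] of nullity [(eta A).+1]; the default [fullv] is
   never reached for the [V] summed over. *)
pose f V := odflt fullv [pick B | atom V B].
have fP V : (A <= V)%VS -> eta V = (eta A).+1 ->
  [/\ nullity_atom A (f V), (f V <= V)%VS &
    forall Z, (A <= Z)%VS -> (Z <= V)%VS -> eta Z = (eta A).+1 -> (f V <= Z)%VS].
  move=> sAV eV; rewrite /f; case: pickP => [B /and3P[aB sBV /forallP minB]|noB] /=.
    split=> // Z sAZ sZV eZ; have /implyP := minB Z; apply.
    by rewrite sAZ sZV eZ eqxx.
  have [B [aB sBV minB]] := nullity_atom_exists sAV eV.
  have /and3P[] := noB B; split=> //; apply/forallP=> Z.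
  by apply/implyP=> /and3P[sAZ sZV /eqP]; apply: minB.
have QE V : Q V && (eta V != eta A) ->
    [/\ (A <= V)%VS, eta V = (eta A).+1 & eta (V :&: H)%VS = eta A].
  case/andP=> /andP[sAV /eqP eVH] neV; split=> //.
  by have := nullityS rhoP sAV; have := eH V; lia.
rewrite (partition_big f (fun B => nullity_atom A B && ~~ (B <= H)%VS)) /=; last first.
  move=> V /QE[sAV eV eVH]; have [aB sBV _] := fP V sAV eV.
  rewrite aB; apply/negP => sBH; have /nullity_atomP[_ eB _] := aB.
  have /(nullityS rhoP) : (f V <= V :&: H)%VS by rewrite subv_cap sBV.
  by rewrite eB eVH ltnn.
apply: eq_bigr => B /andP[aB sBH]; have /nullity_atomP[sAB eB minB] := aB.
apply: eq_bigl => V; apply/andP/andP=> [[QV /eqP fV]|[sBV /eqP eV]].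
  have [sAV eV _] := QE V QV; have [_ sBV _] := fP V sAV eV.
  by rewrite -fV sBV fV eB eV.
have sAV := subv_trans sAB sBV; rewrite eB in eV.
have [aV sfV minV] := fP V sAV eV; have /nullity_atomP[sAf ef _] := aV.
have fVB : f V = B by apply: minB; rewrite ?minV.
rewrite fVB eqxx eV eqn_leq ltnn andbT /=; split=> //.
(* Otherwise [V :&: H] has the nullity of [V], hence contains [f V = B], which puts [B] inside
   [H]. *)
rewrite /Q sAV /=; apply: contraR sBH => neVH.
rewrite (subv_trans _ (capvSr V H)) // -fVB minV ?capvSl ?subv_cap ?sAV //.
have := nullityS rhoP (capvSl V H); have : (A <= V :&: H)%VS by rewrite subv_cap sAV.
move=> /(nullityS rhoP); lia.
Qed.

Lemma mu_above_sign A : 0 <= (-1) ^+ (eta fullv + eta A) * mu_above A.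
Proof.
have [k] := ubnP (n - \dim A)%N; elim: k A => // k IHk A; rewrite ltnS => leAk.
have [->|ntA] := eqVneq A fullv.
  rewrite /mu_above (big_pred1 fullv) => [|V]; last first.
    rewrite /= eqEsubv subvf /= andb_idr // => sV.
    by rewrite eqn_leq !(nullityS rhoP) ?subvf.
  by rewrite dim_fullrV subnn addnn -signr_odd odd_double.
have [H [sAH _]] := hyperplane_between (subvf A) ntA; rewrite dim_fullrV => dH.
(* The minus sign of the recursion is absorbed by [eta B = (eta A).+1]. *)
rewrite (mu_above_rec sAH dH) mulrN -mulNr -mulN1r -exprS mulr_sumr.
apply: sumr_ge0 => B /andP[/nullity_atomP[sAB eB _] _].
rewrite -addnS -eB IHk // (leq_trans _ leAk) //.
have : (\dim A < \dim B)%N.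
  by rewrite ltn_dimv //; apply: contra_eq_neq eB => <-; lia.
by have := dimv_le_n B; lia.
Qed.

(** Expand the indicator of [W = fullv] as the sum of $\mu(V,E)$ over [V] above [W]; after
    exchanging sums, the coefficient at [V] is the indicator of independence. *)
Lemma spanning_sum_full : spanning_sum rho fullv = mu_above 0%VS.
Proof.
transitivity (\sum_W spanning_sum rho W * (W == fullv)%:R).
  rewrite (bigD1 fullv) //= eqxx mulr1 big1 ?addr0 // => W /negPf->.
  exact: mulr0.
transitivity (\sum_W \sum_(V | (W <= V)%VS) spanning_sum rho W * qmu q (n - \dim V)).
  by apply: eq_bigr => W _; rewrite -mulr_sumr sum_qmu_codim_above.
rewrite (exchange_big_dep predT) //= /mu_above big_mkcond [RHS]big_mkcond.
apply: eq_bigr => V _.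
rewrite -mulr_suml sum_spanning_sum // independentE // sub0v nullity0.
by case: eqP; rewrite ?mul1r ?mul0r.
Qed.

End SignOfMobius.

(** * Coloops, the value $g(E)$, and the Euler characteristic as a Möbius sum *)

Section Coloops.

Variables (F : finFieldType) (n : nat).
Local Notation subsp := {vspace 'rV[F]_n}.
Local Notation q := #|F|.
Variable rho : subsp -> nat.
Hypothesis rhoP : is_qmatroid rho.
Implicit Types (H U V : subsp) (x : 'rV[F]_n).
Local Notation eta := (nullity rho).

Lemma perp_lineE x : perp <[x]> = lker (linfun (mulmxr x^T) : 'Hom('rV[F]_n, 'rV[F]_1)).
Proof.
apply/eqP; rewrite eqEsubv; apply/andP; split.
  apply/span_subvP => v; rewrite mem_filter => /andP[/forallP/(_ x)/implyP].
  by rewrite memv_line memv_ker lfunE /= => ->.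
apply/subvP => v; rewrite memv_ker lfunE /= => /eqP vx0.
apply: memv_span; rewrite mem_filter mem_enum andbT.
apply/forallP=> y; apply/implyP=> /vlineP[k ->].
by rewrite linearZ /= -scalemxAr vx0 scaler0.
Qed.

Lemma dim_perp_line x : x != 0 -> (\dim (perp <[x]>)).+1 = n.
Proof.
move=> x0; rewrite perp_lineE; set f := linfun _.
have := limg_ker_dim f fullv; rewrite capfv dim_fullrV.
suff -> : \dim (f @: fullv) = 1%N by rewrite addn1.
apply/eqP; rewrite eqn_leq; apply/andP; split.
  by rewrite (leq_trans (dimvS (subvf _))) ?dim_fullrV.
rewrite lt0n dimv_eq0; apply: contraNneq x0 => f0.
apply/eqP/rowP => j; rewrite mxE.
have : f (delta_mx 0 j) \in (f @: fullv)%VS by rewrite memv_img ?memvf.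
by rewrite f0 memv0 lfunE /= -rowE => /eqP/matrixP/(_ 0 0); rewrite !mxE.
Qed.

Lemma hyperplane_perp_line H : (\dim H).+1 = n -> exists2 x, x != 0 & H = perp <[x]>.
Proof.
move=> dH; pose M : 'M[F]_(\dim H, n) := \matrix_(i, j) (vbasis H)`_i 0 j.
(* The rows of [M] form a basis of [H]; being fewer than [n], they admit a nonzero vector orthogonal
   to all of them. *)
have kM : kermx M^T != 0.
  rewrite -mxrank_eq0 mxrank_ker subn_eq0 -ltnNge.
  have := rank_leq_col M^T; lia.
exists (nz_row (kermx M^T)); first by rewrite nz_row_eq0.
have := dim_perp_line; set x := nz_row _ => /(_ x); rewrite nz_row_eq0 => /(_ kM) dx.
have xM : x *m M^T = 0 by apply/sub_kermxP; exact: nz_row_sub.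
apply/eqP; rewrite eqEdim -ltnS dx dH leqnn andbT perp_lineE.
rewrite -(span_basis (vbasisP H)); apply/span_subvP => v /(nthP 0)[i].
rewrite size_tuple => lt_i <-; rewrite memv_ker lfunE /=; apply/eqP.
transitivity ((row (Ordinal lt_i) M) *m x^T).
  by congr (_ *m _); apply/rowP=> j; rewrite !mxE.
by rewrite -[M]trmxK -row_mul -trmx_mul xM trmx0 row0.
Qed.

(** For a line [X], $\rho^*(X)=0$ says that from $E$ to the hyperplane [perp X] the rank drops by
    one, just as the dimension does; every hyperplane is such a [perp X]. *)
Lemma coloopP :
  reflect (exists2 H, (\dim H).+1 = n & eta H = eta fullv) [exists X, is_coloop rho X].
Proof.
have rhoE H : (\dim H).+1 = n ->
    (1%:Z - (qrank rho)%:Z + (rho H)%:Z == 0) = (eta H == eta fullv).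
  move=> dH; rewrite /qrank; have := nullityK rhoP H; have := nullityK rhoP fullv.
  by rewrite dim_fullrV => ? ?; apply/eqP/eqP; lia.
apply: (iffP existsP) => [[X /andP[/eqP dX]]|[H dH /eqP eH]].
  have XE : X = <[vpick X]>%VS.
    apply/esym/eqP; rewrite eqEdim -memvE memv_pick dX dim_vline vpick0.
    by rewrite -dimv_eq0 dX.
  have x0 : vpick X != 0 by rewrite vpick0 -dimv_eq0 dX.
  have dH : (\dim (perp X)).+1 = n by rewrite XE dim_perp_line.
  by rewrite /rho_dual dX rhoE // => /eqP eH; exists (perp X).
have [x x0 HE] := hyperplane_perp_line dH.
exists <[x]>%VS; rewrite /is_coloop /rho_dual dim_vline x0 eqxx -HE /=.
by rewrite rhoE.
Qed.

Lemma spanning_sum_mubar : spanning_sum rho fullv = (-1) ^+ eta fullv * (mubar rho)%:R.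
Proof.
rewrite /mubar; case: coloopP => [[H dH eH]|noloop].
  rewrite mulr0; apply: spanning_sum_hyperplane eH => //; first exact: subvf.
  by apply: contra_eq_neq dH => ->; rewrite dim_fullrV; lia.
(* Without a coloop $E$ is a q-cycle, hence the maximum of $L$: a proper subspace of the same
   nullity would lie in a hyperplane of that nullity. *)
have cf : is_qcycle rho fullv.
  apply/qcycle_ofP; split=> // U sU neU; apply: contra_not_neq noloop => eU.
  have [H [sUH _ dH]] := hyperplane_between sU neU.
  exists H; first by rewrite dH dim_fullrV.
  by apply/eqP; rewrite eqn_leq -{2}eU !(nullityS rhoP) ?subvf.
have cyc_top : cycle_top rho = fullv.
  by apply/eqP; rewrite eqEsubv subvf (sumv_sup fullv).
have gE : (mobius_L rho)%:~R = spanning_sum rho fullv.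
  by rewrite /mobius_L cyc_top mobius_fuelE.
(* The sign rule makes $(-1)^{\eta(E)}\mu(L)$ nonnegative, hence equal to $|\mu(L)|$. *)
have := mu_above_sign rhoP 0%VS; rewrite -spanning_sum_full // nullity0 addn0 -gE.
rewrite natr_absz => sg.
have /(congr1 (fun y => (-1) ^+ eta fullv * y)) := ger0_norm sg.
by rewrite normrM normr_sign mul1r signrMK intr_norm => ->.
Qed.

(** The join of a nonempty chain is its largest member, so all members are independent iff the join
    is; grouping by the join then applies Hall's theorem. *)
Lemma chi_order_complexE :
  (chi_order_complex rho)%:~R = - \sum_(V | independent rho V) qmu q (\dim V).
Proof.
have chainE (Y : {set subsp}) :
    is_indep_chain rho Y = nz_chain Y && independent rho (join Y).
  apply/andP/andP => [[/forall_inP nzi cY]|[/andP[/forall_inP nz cY] iY]].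
    have ncY : nz_chain Y.
      by rewrite /nz_chain cY andbT; apply/forall_inP=> V /nzi/andP[].
    split=> //; have [->|ntY] := eqVneq Y set0.
      by rewrite join0 independentE // nullity0.
    by have /andP[] := nzi _ (nz_chain_join ncY ntY).
  split=> //; apply/forall_inP=> V VY; rewrite nz //=.
  exact: independentS (sub_join VY) iY.
transitivity (- \sum_(Y | is_indep_chain rho Y) (-1) ^+ #|Y| : rat); last first.
  congr (- _); rewrite (eq_bigl _ _ chainE).
  rewrite (partition_big (@join _ _) (independent rho)) => [|Y /andP[]//].
  apply: eq_bigr => V iV; rewrite -sum_nz_chain; apply: eq_bigl => Y.
  by rewrite -andbA; congr (_ && _); rewrite andb_idl // => /eqP->.
rewrite /chi_order_complex rmorph_sum -sumrN.
rewrite (partition_big (fun Y : {set subsp} =>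
  inord #|Y| : 'I_#|{: subsp}|.+1) predT) //=.
apply: eq_bigr => k _; rewrite rmorphM rmorph_sign /nfaces.
rewrite (eq_bigl (mem [set Y | is_indep_chain rho Y & #|Y| == k])); last first.
  move=> Y; rewrite !inE; congr (_ && _).
  by rewrite -val_eqE /= inordK // ltnS max_card.
rewrite (eq_bigr (fun=> (-1) ^+ k.+1)).
  by rewrite sumr_const mulr_natr.
by move=> Y; rewrite /= inE => /andP[_ /eqP->]; rewrite exprS mulN1r.
Qed.

End Coloops.

(** * Grouping sets of q-circuits by the codimension of their span *)

Section EulerCharacteristic.

Variables (F : finFieldType) (n : nat).
Local Notation subsp := {vspace 'rV[F]_n}.
Local Notation q := #|F|.
Variable rho : subsp -> nat.
Hypothesis rhoP : is_qmatroid rho.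
Implicit Types (V : subsp).

(** The sum of $\mu(0,V)$ over all [V] above a fixed subspace of codimension [l]. *)
Definition qmu_above_sum (l : nat) : rat :=
  \sum_(0 <= j < l.+1) gauss_binom q l j * qmu q (n - j).

Definition codim_join (X : {set subsp}) := (n - \dim (join X))%N.

Lemma codim_join_eq0 (X : {set subsp}) : (codim_join X == 0)%N = (join X == fullv).
Proof. by rewrite /codim_join subn_eq0 eqEdim subvf dim_fullrV. Qed.

Lemma qmu_above_sum0 : qmu_above_sum 0 = qmu q n.
Proof. by rewrite /qmu_above_sum big_nat1 gauss_binom0 mul1r subn0. Qed.

Lemma qmu_above_sum_n : (0 < n)%N -> qmu_above_sum n = 0.
Proof.
move=> n0; have := sum_above (0%VS : subsp) (qmu q).
rewrite dimv0 subn0 -/(qmu_above_sum n) => <-.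
have := sum_qmu_below (fullv : subsp).
have -> : (fullv == 0%VS :> subsp) = false.
  by rewrite -dimv_eq0 dim_fullrV; apply/negbTE; rewrite -lt0n.
by move=> E; rewrite -[RHS]E; apply: eq_bigl => V; rewrite sub0v subvf.
Qed.

Lemma chi_order_complex_codim :
  (chi_order_complex rho)%:~R
  = - \sum_(0 <= l < n.+1)
        (\sum_(X : {set subsp} | (X \subset qcircuits rho) && (codim_join X == l))
           (-1) ^+ #|X|) * qmu_above_sum l :> rat.
Proof.
rewrite chi_order_complexE //; congr (- _).
rewrite big_mkcond.
transitivity (\sum_V
  \sum_(X : {set subsp} | (X \subset qcircuits rho) && (join X <= V)%VS)
    (-1) ^+ #|X| * qmu q (\dim V)).
  apply: eq_bigr => V _; rewrite -mulr_suml sum_sign_qcircuits_sub //.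
  by case: independent; rewrite ?mul1r ?mul0r.
rewrite (exchange_big_dep (fun X : {set subsp} =>
  X \subset qcircuits rho)) /=; last first.
  by move=> V X _ /andP[].
rewrite big_mkord (partition_big (fun X => inord (codim_join X) : 'I_n.+1) predT) //=.
apply: eq_bigr => l _; rewrite mulr_suml.
have inordE X : (inord (codim_join X) == l) = (codim_join X == l).
  by rewrite -val_eqE /= inordK // ltnS leq_subr.
apply: eq_big => [X|X /andP[sX]]; rewrite inordE // => /eqP <-.
rewrite sX /= -mulr_sumr; congr (_ * _).
exact: sum_above.
Qed.

Lemma sum_sign_lambda l : (l < n)%N ->
  \sum_(X : {set subsp} | (X \subset qcircuits rho) && (codim_join X == l))
     (-1) ^+ #|X|
  = \sum_(1 <= i < #|qcircuits rho|.+1) (lambda rho i l)%:R * (-1) ^+ i :> rat.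
Proof.
move=> ltln; set s := #|_|.
(* The empty set spans [0], of codimension [n], so [l < n] lets the sum start at [i = 1]. *)
have lambda0 : lambda rho 0 l = 0%N.
  apply/eqP; rewrite cards_eq0 -subset0; apply/subsetP=> X.
  rewrite inE cards_eq0 => /and3P[_ /eqP-> ].
  by rewrite big_set0 dimv0 subn0 gtn_eqF.
transitivity (\sum_(0 <= i < s.+1) (lambda rho i l)%:R * (-1) ^+ i : rat); last first.
  by rewrite big_ltn // lambda0 mul0r add0r.
rewrite big_mkord (partition_big (fun X : {set subsp} =>
  inord #|X| : 'I_s.+1) predT) //=.
apply: eq_bigr => i _.
rewrite (eq_bigl (mem [set X : {set subsp} | [&& X \subset qcircuits rho, #|X| == i
    & codim_join X == l]])) => [|X]; last first.
  rewrite /= inE -andbA; have [/subset_leq_card sX|//] := boolP (X \subset _).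
  by rewrite -val_eqE /= inordK // andbC.
rewrite (eq_bigr (fun=> (-1) ^+ i)) => [|X]; last by rewrite /= inE => /and3P[_ /eqP->].
by rewrite sumr_const -[LHS]mulr_natl.
Qed.

End EulerCharacteristic.

(** * Assembly of the contributions of codimension $0$, $0<l<n$ and $n$ *)

Theorem theorem4p2 (F : finFieldType) (n : nat)
    (rho : {vspace 'rV[F]_n} -> nat) :
  is_qmatroid rho ->
  let q := #|F| in
  let r := qrank rho in
  let s := #|qcircuits rho| in
  ((chi_order_complex rho)%:~R : rat) =
    (-1) ^+ r.+1 * (q ^ 'C(n, 2))%:R * (mubar rho)%:R
    + \sum_(1 <= l < n) \sum_(1 <= i < s.+1)
        (lambda rho i l)%:R *
        \sum_(0 <= j < l.+1)
          (-1) ^+ (n + i + j - 1) * (q ^ 'C(n - j, 2))%:R * gauss_binom q l j.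
Proof.
move=> rhoP q r s; rewrite chi_order_complex_codim // big_ltn // opprD.
congr (_ + _).
  (* As $n=\eta(E)+r$, the sign $-(-1)^n(-1)^{\eta(E)}$ becomes $(-1)^{r+1}$. *)
  rewrite qmu_above_sum0 (eq_bigl _ _ (fun X => congr1 (andb _) (codim_join_eq0 X))).
  rewrite -/(spanning_sum rho fullv) spanning_sum_mubar // /qmu.
  have -> : (-1) ^+ n = (-1) ^+ nullity rho fullv * (-1) ^+ r :> rat.
    by rewrite -exprD /r nullityK // dim_fullrV.
  rewrite -/q exprS.
  have := sqrr_sign rat (nullity rho fullv).
  move: ((-1) ^+ nullity rho fullv) ((-1) ^+ r) (q ^ _)%:R (mubar rho)%:R => e t Q m.
  by move=> e1; ring: e1.
have -> : \sum_(1 <= l < n.+1)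
     (\sum_(X : {set {vspace 'rV[F]_n}} |
         (X \subset qcircuits rho) && (codim_join X == l))
           (-1) ^+ #|X|) * qmu_above_sum F n l
  = \sum_(1 <= l < n) (\sum_(1 <= i < s.+1) (lambda rho i l)%:R * (-1) ^+ i)
      * qmu_above_sum F n l.
  (* The term [l = n] vanishes for [n > 0]; for [n = 0] it is the term [l = 0] already split off,
     and both ranges are empty. *)
  case: (posnP n) => [n0|n0]; first by rewrite !big_geq // n0.
  rewrite big_nat_recr //= qmu_above_sum_n // mulr0 addr0 !big_nat.
  by apply: eq_bigr => l /andP[_ ltln]; rewrite sum_sign_lambda.
rewrite -sumrN !big_nat; apply: eq_bigr => l /andP[_ ltln].
rewrite mulr_suml -sumrN !big_nat; apply: eq_bigr => i /andP[i0 _].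
rewrite -mulrA -mulrN; congr (_ * _).
rewrite mulr_sumr -sumrN !big_nat; apply: eq_bigr => j /andP[_ lejl].
rewrite /qmu -/q.
(* Neither subtraction truncates, since [i >= 1] and [j <= l < n], so comparing parities is
   enough. *)
have -> : (-1) ^+ (n + i + j - 1) = - ((-1) ^+ i * (-1) ^+ (n - j)) :> rat.
  rewrite -exprD -[RHS]mulN1r -exprS -[LHS]signr_odd -[RHS]signr_odd.
  congr (_ ^+ nat_of_bool _); lia.
move: (_ ^+ i) (_ ^+ (n - j)) (q ^ _)%:R (gauss_binom q l j) => x y Q g; ring.
Qed.
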